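(* Let $K$ be a compact connected abelian subgroup of $SO(d)$ and let $a\in K$ be such that the closed subgroup generated by $a$ is $K$. Let $S=(E,\mathcal{A},\rho,\tau)$ be a dynamical system and let $f\colon E\to[0,1]$ be a measurable function such that $f(1-f)\in\mathcal{C}_2(S)$ and such that $f$ is not ($\rho$-almost everywhere equal to) an indicator function, i.e. a function with values in $\{0,1\}$. For $x\in E$ let $(R_j)_{j\ge1}$ be independent $K$-valued random variables with $$P(R_j=a)=f(\tau^jx),\qquad P(R_j=a^{-1})=1-f(\tau^jx).$$ Then, for $\rho$-almost every $x\in E$, the product $R_1R_2\cdots R_n$ converges in law, as $n\to\infty$, to the normalized Haar measure on $K$.
   Context: A dynamical system $S=(E,\mathcal{A},\rho,\tau)$ consists of a probability space $(E,\mathcal{A},\rho)$ and a (measurable) transformation $\tau\colon E\to E$. The class $\mathcal{C}_2(S)$ is the set of functions $g\in L^1(E,\rho)$ such that $$\sup_{x\in E}\Big|\sum_{i=1}^n\Big(g(\tau^ix)-\int_E g\,d\rho\Big)\Big|=o(\sqrt n)\quad\text{as }n\to\infty.$$ *)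

(* Defs.v *)
From HB Require Import structures.
From mathcomp Require Import all_boot all_order all_algebra finmap.
From mathcomp Require Import all_classical all_reals all_analysis.
Set Implicit Arguments.
Unset Strict Implicit.
Unset Printing Implicit Defensive.
Import Order.TTheory GRing.Theory Num.Theory numFieldNormedType.Exports.
Local Open Scope classical_set_scope.
Local Open Scope ring_scope.

Section MatrixGroups.
Context {R : realType} {d : nat}.

Definition special_orthogonal : set 'M[R]_d :=
  [set A | A *m A^T = 1%:M /\ \det A = 1].

Definition is_subgroup_SO (H : set 'M[R]_d) : Prop :=
  [/\ H `<=` special_orthogonal,
      H 1%:M,
      (forall A B, H A -> H B -> H (A *m B)) &
      (forall A, H A -> H (invmx A))].

Definition is_abelian (H : set 'M[R]_d) : Prop :=
  forall A B, H A -> H B -> A *m B = B *m A.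

(* As SO(d) is closed in 'M[R]_d, being closed in SO(d) and being closed in
   'M[R]_d amount to the same thing for subgroups of SO(d). *)
Definition closed_subgroup_generated (a : 'M[R]_d) : set 'M[R]_d :=
  smallest (fun H => is_subgroup_SO H /\ closed H) [set a].

End MatrixGroups.

(* 'M[R]_d with its Borel sigma-algebra *)
Definition borel_mx (R : realType) (d : nat) :=
  g_sigma_algebraType (@open 'M[R]_d).

(* The normalized Haar measure of K, seen as a Borel probability measure on
   'M[R]_d carried by K. *)
Definition is_haar_measure (R : realType) (d : nat) (K : set 'M[R]_d)
    (mu : probability (borel_mx R d) R) : Prop :=
  mu K = 1%E /\
  forall (k : 'M[R]_d) (B : set (borel_mx R d)),
    K k -> measurable B -> B `<=` K -> mu [set k *m b | b in B] = mu B.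

(* The supremum is taken in the extended reals, so that it cannot be finite by
   convention when the sums are unbounded in x. *)
Definition class_C2 (R : realType) (dE : measure_display)
    (E : measurableType dE) (rho : probability E R) (tau : E -> E)
    (g : E -> R) : Prop :=
  rho.-integrable setT (EFin \o g) /\
  forall eps : R, 0 < eps ->
    \forall n \near \oo,
      (ereal_sup [set `|\sum_(1 <= i < n.+1)
          (g (iter i tau x) - \int[rho]_(y in setT) g y)|%:E | x in setT]
        <= (eps * Num.sqrt n%:R)%:E)%E.

Definition mutually_independent (R : realType) (dO : measure_display)
    (Omega : measurableType dO) (P : probability Omega R)
    (dT : measure_display) (T : measurableType dT)
    (I : set nat) (X : nat -> Omega -> T) : Prop :=
  forall (J : {fset nat}) (B : nat -> set T),
    [set` J] `<=` I ->
    (forall j, j \in J -> measurable (B j)) ->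
    P (\bigcap_(j in [set` J]) (X j @^-1` B j)) =
    (\prod_(j <- J) P (X j @^-1` B j))%E.

(* Convergence in law of the K-valued variables Z n to mu: weak convergence,
   tested on the bounded continuous functions K -> R. *)
Definition cvg_in_law (R : realType) (d : nat) (dO : measure_display)
    (Omega : measurableType dO) (P : probability Omega R)
    (K : set 'M[R]_d) (Z : nat -> Omega -> 'M[R]_d)
    (mu : probability (borel_mx R d) R) : Prop :=
  forall phi : 'M[R]_d -> R,
    {within K, continuous phi} ->
    (exists M : R, forall k, K k -> `|phi k| <= M) ->
    (fun n => \int[P]_(w in setT) phi (Z n w)) @ \oo
      --> \int[mu]_(k in K) phi k.

(* Main.v *)
Require Import Defs.
From HB Require Import structures.
From mathcomp Require Import all_boot all_order all_algebra finmap.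
From mathcomp Require Import all_classical all_reals all_analysis.
From mathcomp Require Import measurable_realfun ring lra.
Set Implicit Arguments.
Unset Strict Implicit.
Unset Printing Implicit Defensive.
Import Order.TTheory GRing.Theory Num.Theory numFieldNormedType.Exports.
Local Open Scope classical_set_scope.
Local Open Scope ring_scope.

(** Write $p_j = f(\tau^j x)$ and let $h_n(k)$ be the mean of
    $\varphi(k R_1 \cdots R_n)$; since $K$ is abelian,
    $h_{n+1}(k) = p_{n+1} h_n(ka) + (1 - p_{n+1}) h_n(ka^{-1})$.
    The proof shows that $h_n$ flattens: its oscillation on $K$ tends to 0.
    Each step preserves the Haar integral, so $h_n(1)$, which is the mean of
    $\varphi(R_1 \cdots R_n)$, then tends to the Haar integral of $\varphi$
    ([walk_mean_cvg]).

    The engine is the identity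
    $\|pu + (1-p)v\|^2 = p\|u\|^2 + (1-p)\|v\|^2 - p(1-p)\|u-v\|^2$ in
    $L^2$ of the Haar measure.  Applied to the two translates of $h_n$, which
    have the same norm as $h_n$, it says that step $n+1$ costs the energy
    $\|h_n\|^2$ the amount $p_{n+1}(1-p_{n+1}) \|w_n\|^2$, where
    $w_n(k) = h_n(ka) - h_n(ka^{-1})$.  As $w_n$ obeys the same recursion as
    $h_n$, its norm does not increase, so that
    $\|w_n\|^2 \sum_{i \le n} p_i(1-p_i) \le \|\varphi\|^2$
    ([haar_int_sqr_walk_mean_diff_le]).

    The sum diverges for every $x$: since $f$ is not an indicator, $f(1-f)$ has
    a positive integral, and its Birkhoff sums differ from $n$ times this
    integral by $o(\sqrt n)$, uniformly in $x$ ([class_C2_sum_diverge]).  Hence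
    $\|w_n\| \to 0$.

    Averaging keeps the modulus of continuity of $\varphi$, and nonempty open
    sets of $K$ have positive Haar measure, so $w_n \to 0$ uniformly: the
    function $h_n$ is asymptotically invariant under translation by $a^2$
    ([asymptotic_period_sqr]).  The asymptotic periods form a closed subgroup of
    $K$.  It contains $a^2$, and connectedness of $K$ makes $a^2$ generate
    $K$ as well as $a$ does ([square_generates]); so every element of $K$ is an
    asymptotic period, which is the announced flattening.

    The recursion for the means is obtained from independence by conditioning
    on the last step ([Rintegral_walk_cylinder]). *)

(** * Topology and Borel sets of square matrices *)

Lemma continuous_mx (R : realType) (T : topologicalType) (m n : nat)
    (F : T -> 'M[R]_(m, n)) :
  (forall i j, continuous (fun x => F x i j)) -> continuous F.
Proof.
move=> cF x A [P P_nbhs PA].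
have : \forall y \near x, forall i j, P i j (F y i j).
  apply: filter_forall => i; apply: filter_forall => j.
  by apply: (cF i j x); exact: P_nbhs.
by apply: filterS => y Py; apply: PA => i j; exact: Py.
Qed.

Lemma mulmx_continuous (R : realType) (d : nat) :
  continuous (fun p : 'M[R]_d * 'M[R]_d => p.1 *m p.2).
Proof.
apply: continuous_mx => i j p /=.
have -> : (fun q : 'M[R]_d * 'M[R]_d => (q.1 *m q.2) i j) =
    fun q => \sum_(k < d) q.1 i k * q.2 k j.
  by apply/funext => q; rewrite mxE.
apply: cvg_big => [|k _]; first exact: add_continuous.
apply: cvgM.
- apply: (@continuous_comp _ _ _ fst (fun A : 'M[R]_d => A i k)).
    exact: cvg_fst.
  exact: coord_continuous.
- apply: (@continuous_comp _ _ _ snd (fun A : 'M[R]_d => A k j)).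
    exact: cvg_snd.
  exact: coord_continuous.
Qed.

Lemma mulmxl_continuous (R : realType) (d : nat) (A : 'M[R]_d) :
  continuous (fun B : 'M[R]_d => A *m B).
Proof.
move=> B W W_nbhs.
have [[U V] /= [nU nV] UVW] := @mulmx_continuous R d (A, B) W W_nbhs.
apply: filterS nV => C VC; apply: (UVW (A, C)); split => //=.
exact: nbhs_singleton.
Qed.

Lemma mulmxr_continuous (R : realType) (d : nat) (A : 'M[R]_d) :
  continuous (fun B : 'M[R]_d => B *m A).
Proof.
move=> B W W_nbhs.
have [[U V] /= [nU nV] UVW] := @mulmx_continuous R d (B, A) W W_nbhs.
apply: filterS nU => C UC; apply: (UVW (C, A)); split => //=.
exact: nbhs_singleton.
Qed.

Lemma open_measurable_mx (R : realType) (d : nat) (A : set 'M[R]_d) :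
  open A -> measurable (A : set (borel_mx R d)).
Proof. by move=> oA; exact: sub_sigma_algebra. Qed.

Lemma closed_measurable_mx (R : realType) (d : nat) (A : set 'M[R]_d) :
  closed A -> measurable (A : set (borel_mx R d)).
Proof.
by move=> cA; rewrite -[A]setCK; apply: measurableC;
  apply: open_measurable_mx; exact: closed_openC.
Qed.

Lemma continuous_measurable_mx (R : realType) (d : nat)
    (F : 'M[R]_d -> 'M[R]_d) :
  continuous F -> measurable_fun [set: borel_mx R d] (F : _ -> borel_mx R d).
Proof.
move=> cF.
apply: (@measurability _ _ (borel_mx R d) (borel_mx R d) setT F open erefl).
move=> _ [B oB <-]; rewrite setTI; apply: open_measurable_mx.
by move/continuousP: cF; exact.
Qed.

Lemma within_continuous_measurable_mx (R : realType) (d : nat)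
    (K : set 'M[R]_d) (phi : 'M[R]_d -> R) :
  closed K -> {within K, continuous phi} ->
  measurable_fun (K : set (borel_mx R d)) phi.
Proof.
move=> cK cphi; apply: (measurability _ (RGenOpens.measurableE R)).
move=> _ [_ [a [b ->]] <-].
have /open_subspaceP[V oV VK] :
    open (phi @^-1` `]a, b[%classic : set (subspace K)).
  by move/continuousP: cphi; apply; exact: interval_open.
rewrite setIC -VK; apply: measurableI; first exact: open_measurable_mx.
exact: closed_measurable_mx.
Qed.

(** * Closed subgroups of SO(d) *)

Section SubgroupsOfSO.
Context (R : realType) (d : nat).
Implicit Types (A B : 'M[R]_d) (H K S : set 'M[R]_d).

Lemma so_unitmx A : special_orthogonal A -> A \in unitmx.
Proof. by move=> [/mulmx1_unit[]]. Qed.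

Lemma so_group_unitmx H A : is_subgroup_SO H -> H A -> A \in unitmx.
Proof. by move=> [HSO _ _ _] /HSO; exact: so_unitmx. Qed.

Lemma nbhs_mulVmx A (W : set 'M[R]_d) : A \in unitmx ->
  nbhs (1%:M : 'M[R]_d) W -> nbhs A [set B | W (invmx A *m B)].
Proof.
move=> uA W1; apply: (@mulmxl_continuous R d (invmx A) A W).
by rewrite /= mulVmx.
Qed.

(** The set $S \cup aS$ is a closed subgroup containing $a$, hence all of $K$.
    If $a \notin S$ the two cosets are disjoint and closed, so $S$ is also
    relatively open, and connectedness gives $S = K$. *)
Lemma square_generates K (a : 'M[R]_d) S :
  is_subgroup_SO K -> is_abelian K -> connected K -> K a ->
  closed_subgroup_generated a = K ->
  is_subgroup_SO S -> closed S -> S `<=` K -> S (a *m a) -> S = K.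
Proof.
move=> Kgrp Kab Kconn Ka Kgen Sgrp Scl SK Saa.
have [KSO K1 KM KV] := Kgrp; have [SSO S1 SM SV] := Sgrp.
have ua : a \in unitmx := so_group_unitmx Kgrp Ka.
have generated T : is_subgroup_SO T -> closed T -> T a -> K `<=` T.
  move=> Tgrp Tcl Ta; rewrite -Kgen; apply: smallest_sub => //.
  by move=> _ ->.
have [Sa|nSa] := pselect (S a).
  by apply/seteqP; split => //; exact: generated.
(* The coset $aS$, written as a preimage so that it is visibly closed. *)
pose aS : set 'M[R]_d := [set B | S (invmx a *m B)].
have aScl : closed aS.
  by move/continuous_closedP: (@mulmxl_continuous R d (invmx a)); exact.
have KVa := KV _ Ka.
have aSK : aS `<=` K.
  by move=> B /SK KB; rewrite -(mulKVmx ua B); exact: KM.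
have SaS_disj B : S B -> ~ aS B.
  move=> SB aSB; apply: nSa; rewrite -(invmxK a); apply: (SV _ _).
  have uB := so_group_unitmx Sgrp SB.
  rewrite -(mulmxK uB (invmx a)); apply: SM => //; exact: SV.
have cover : K `<=` S `|` aS.
  apply: generated.
  - split.
    + by move=> B [/SSO//|/aSK/KSO].
    + by left.
    + move=> B C [SB|aSB] [SC|aSC].
      * by left; exact: SM.
      * right; rewrite /aS/= mulmxA (Kab (invmx a) B) ?SK//; last exact: SK.
        by rewrite -mulmxA; exact: SM.
      * by right; rewrite /aS/= mulmxA; exact: SM.
      * left.
        have -> : B *m C = a *m a *m ((invmx a *m B) *m (invmx a *m C)).
          rewrite -mulmxA (mulmxA a (invmx a *m B)) mulKVmx//.
          by rewrite (mulmxA a B) (Kab a B Ka (aSK _ aSB)) -mulmxA mulKVmx.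
        by apply: (SM _ _ Saa); exact: SM.
    + move=> B [SB|aSB]; first by left; exact: SV.
      right; rewrite /aS/=.
      have KB := aSK _ aSB; have uB := so_group_unitmx Kgrp KB.
      pose Y := a *m a *m (invmx a *m B).
      have SY : S Y by exact: SM.
      have uY := so_group_unitmx Sgrp SY.
      have XY1 : invmx a *m invmx B *m Y = 1%:M.
        rewrite /Y -(mulmxA a) mulKVmx// (Kab a B)// -mulmxA (mulmxA _ B).
        by rewrite mulVmx// mul1mx mulVmx.
      by rewrite -(mulmxK uY (_ *m invmx B)) XY1 mul1mx; exact: SV.
  - exact: closedU.
  - by right; rewrite /aS/= mulVmx.
have SE : S = K `&` ~` aS.
  apply/seteqP; split=> B.
    by move=> SB; split; [exact: SK|exact: SaS_disj].
  by move=> [/cover[]].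
apply: Kconn; first by exists 1%:M.
  by exists (~` aS) => //; rewrite openC.
by exists S => //; rewrite setIidr.
Qed.

End SubgroupsOfSO.

(** * Integration against the Haar measure of K *)

Section HaarIntegral.
Context (R : realType) (d : nat) (K : set 'M[R]_d)
  (haar : probability (borel_mx R d) R).
Context (Kgrp : is_subgroup_SO K) (Kab : is_abelian K) (Kcpt : compact K)
  (haarK : is_haar_measure K haar).
Implicit Types (h u v : 'M[R]_d -> R) (y k : 'M[R]_d).

Definition bounded_on h := exists M, forall k, K k -> `|h k| <= M.

Definition bounded_measurable h :=
  measurable_fun (K : set (borel_mx R d)) (h : borel_mx R d -> R) /\
  bounded_on h.

Definition haar_int h := \int[haar]_(k in (K : set (borel_mx R d))) h k.

Lemma compact_group_closed : closed K.
Proof. by apply: compact_closed => //; exact: norm_hausdorff. Qed.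

Lemma compact_group_measurable : measurable (K : set (borel_mx R d)).
Proof. by apply: closed_measurable_mx; exact: compact_group_closed. Qed.
Local Hint Resolve compact_group_measurable : core.

Lemma bounded_measurableD u v : bounded_measurable u -> bounded_measurable v ->
  bounded_measurable (fun k => u k + v k).
Proof.
move=> [mu [M uM]] [mv [N vN]]; split; first exact: measurable_funD.
exists (M + N) => k Kk; apply: le_trans (ler_normD _ _) _.
by apply: lerD; [exact: uM|exact: vN].
Qed.

Lemma bounded_measurableM u v : bounded_measurable u -> bounded_measurable v ->
  bounded_measurable (fun k => u k * v k).
Proof.
move=> [mu [M uM]] [mv [N vN]]; split; first exact: measurable_funM.
exists (M * N) => k Kk; rewrite normrM.
by apply: ler_pM => //; [exact: uM|exact: vN].
Qed.

Lemma bounded_measurable_cst (c : R) : bounded_measurable (fun=> c).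
Proof. by split; [exact: measurable_cst|exists `|c|]. Qed.

Lemma bounded_measurableB u v : bounded_measurable u -> bounded_measurable v ->
  bounded_measurable (fun k => u k - v k).
Proof.
move=> bu bv; have := bounded_measurableM (bounded_measurable_cst (-1)) bv.
move/(bounded_measurableD bu); congr bounded_measurable.
by apply/funext => k /=; rewrite mulN1r.
Qed.

Lemma bounded_measurable_transl h y : K y -> bounded_measurable h ->
  bounded_measurable (fun k => h (k *m y)).
Proof.
have [_ _ KM _] := Kgrp.
move=> Ky [mh [M hM]]; split; last by exists M => k Kk; apply: hM; exact: KM.
apply: (@measurable_comp _ _ _ _ _ _ (K : set (borel_mx R d)) h
  (K : set (borel_mx R d)) (fun k => k *m y)) => //.
- by move=> _ [k Kk <-]; exact: KM.
- apply: measurable_funTS; apply: continuous_measurable_mx.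
  exact: mulmxr_continuous.
Qed.

Lemma bounded_measurable_integrable h : bounded_measurable h ->
  haar.-integrable (K : set (borel_mx R d)) (EFin \o h).
Proof.
move=> [mh [M hM]]; apply: measurable_bounded_integrable => //.
  by rewrite (le_lt_trans (probability_le1 _ _))// ltry.
exists M; split; first exact: num_real.
by move=> x Mx k /= Kk; apply: le_trans (hM k Kk) (ltW Mx).
Qed.

Lemma haar_intD u v : bounded_measurable u -> bounded_measurable v ->
  haar_int (fun k => u k + v k) = haar_int u + haar_int v.
Proof.
move=> bu bv; apply: RintegralD => //; exact: bounded_measurable_integrable.
Qed.

Lemma haar_intB u v : bounded_measurable u -> bounded_measurable v ->
  haar_int (fun k => u k - v k) = haar_int u - haar_int v.
Proof.
move=> bu bv; apply: RintegralB => //; exact: bounded_measurable_integrable.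
Qed.

Lemma haar_intZ (c : R) h : bounded_measurable h ->
  haar_int (fun k => c * h k) = c * haar_int h.
Proof.
move=> bh; apply: RintegralZl => //; exact: bounded_measurable_integrable.
Qed.

Lemma haar_int_cst (c : R) : haar_int (fun=> c) = c.
Proof.
by rewrite /haar_int Rintegral_cst// [X in fine X](haarK.1) mulr1.
Qed.

Lemma le_haar_int u v : bounded_measurable u -> bounded_measurable v ->
  (forall k, K k -> u k <= v k) -> haar_int u <= haar_int v.
Proof.
move=> bu bv uv; apply: le_Rintegral => //;
  exact: bounded_measurable_integrable.
Qed.

Lemma eq_haar_int u v : (forall k, K k -> u k = v k) -> haar_int u = haar_int v.
Proof. by move=> uv; apply: eq_Rintegral => k /[1!inE]; exact: uv. Qed.

(** Invariance is assumed for images; preimages under $y$ are images under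
    $y^{-1}$. *)
Lemma haar_preimage_mull y (A : set (borel_mx R d)) : K y -> measurable A ->
  A `<=` K -> haar ((fun k => y *m k) @^-1` A) = haar A.
Proof.
move=> Ky mA AK; have [_ _ _ KV] := Kgrp.
have uy := so_group_unitmx Kgrp Ky.
rewrite -(haarK.2 (invmx y) A (KV _ Ky) mA AK); congr (haar _).
apply/seteqP; split=> [k /= Ak|_ [k Ak <-]]; last by rewrite /= mulKVmx.
by exists (y *m k) => //; rewrite mulKmx.
Qed.

Lemma haar_int_transl h y : K y -> bounded_measurable h ->
  haar_int (fun k => h (k *m y)) = haar_int h.
Proof.
move=> Ky bh; have [_ _ KM KV] := Kgrp.
have uy := so_group_unitmx Kgrp Ky.
have myl : measurable_fun [set: borel_mx R d]
    (fun k : borel_mx R d => y *m k : borel_mx R d).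
  by apply: continuous_measurable_mx; exact: mulmxl_continuous.
(* Change of variables requires a function that is measurable everywhere. *)
pose g : borel_mx R d -> \bar R := (EFin \o h) \_ K.
have mg : measurable_fun setT g.
  apply/(measurable_restrictT _ _).1 => //; apply/measurable_EFinP.
  by case: bh.
have preK : (fun k => y *m k) @^-1` K = K.
  apply/seteqP; split=> k /= Kk; last exact: KM.
  by rewrite -(mulKmx uy k); apply: KM => //; exact: KV.
have gE : {in K, (fun k => (h (k *m y))%:E) =1 g \o (fun k => y *m k)}.
  move=> k /[1!inE] Kk; rewrite /g/= patchE mem_set/=; last exact: KM.
  by rewrite Kab.
have ig : haar.-integrable ((fun k => y *m k) @^-1` K) (g \o (fun k => y *m k)).
  rewrite preK; apply: (@eq_integrable _ (borel_mx R d) R haar K _ _ _ gE) => //.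
  by apply: bounded_measurable_integrable; exact: bounded_measurable_transl.
rewrite /haar_int /Rintegral; congr fine.
transitivity (\int[haar]_(k in K) (g \o (fun k => y *m k)) k)%E.
  exact: eq_integral.
rewrite -[in LHS]preK -(integral_pushforward myl mg ig)//.
transitivity (\int[haar]_(k in K) g k)%E.
  apply: eq_measure_integral => A mA AK.
  exact: haar_preimage_mull.
by apply: eq_integral => k Kk; rewrite /g patchE Kk.
Qed.
(** * Energy of the averaged functions *)

Context (a : 'M[R]_d) (Ka : K a).
Context (p : nat -> R) (p01 : forall n, 0 <= p n <= 1).

(** The mean of $h(k R_1 \cdots R_n)$ for independent steps with
    $P(R_j = a) = p_j$ and $P(R_j = a^{-1}) = 1 - p_j$, described by its
    recursion so that it can be studied without any probability space. *)
Fixpoint walk_mean h n : 'M[R]_d -> R :=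
  if n is m.+1 then
    fun k => p n * walk_mean h m (k *m a) +
             (1 - p n) * walk_mean h m (k *m invmx a)
  else h.

Let KM A B : K A -> K B -> K (A *m B).
Proof. by case: Kgrp => _ _ + _; exact. Qed.
Let KV A : K A -> K (invmx A).
Proof. by case: Kgrp => _ _ _; exact. Qed.
Let KVa : K (invmx a). Proof. exact: KV. Qed.

Lemma walk_mean_bound h (M : R) n : (forall k, K k -> `|h k| <= M) ->
  forall k, K k -> `|walk_mean h n k| <= M.
Proof.
move=> hM; elim: n => [//|n IH] k Kk /=.
have /andP[p0 p1] := p01 n.+1.
have q0 : 0 <= 1 - p n.+1 by rewrite subr_ge0.
rewrite (le_trans (ler_normD _ _))// !normrM (ger0_norm p0) (ger0_norm q0).
have H1 := IH _ (KM Kk Ka); have H2 := IH _ (KM Kk KVa).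
have := ler_wpM2l p0 H1; have := ler_wpM2l q0 H2; lra.
Qed.

Lemma walk_mean_bounded_measurable h n :
  bounded_measurable h -> bounded_measurable (walk_mean h n).
Proof.
move=> bh; elim: n => [//|n IH] /=.
by apply: bounded_measurableD; apply: bounded_measurableM;
  [exact: bounded_measurable_cst|exact: bounded_measurable_transl|
   exact: bounded_measurable_cst|exact: bounded_measurable_transl].
Qed.

(** Averaging is linear and commutes with translations, because $K$ is abelian.
    This one form serves both for the modulus of continuity ($y = 1$) and for
    the differences $h_n(ka) - h_n(ka^{-1})$. *)
Lemma walk_meanB_transl h x y n k : K x -> K y -> K k ->
  walk_mean (fun k => h (k *m x) - h (k *m y)) n k =
  walk_mean h n (k *m x) - walk_mean h n (k *m y).
Proof.
move=> Kx Ky; elim: n k => [//|n IH] k Kk /=.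
rewrite !IH; try exact: KM.
rewrite -!mulmxA (Kab Ka Kx) (Kab Ka Ky) (Kab KVa Kx) (Kab KVa Ky); ring.
Qed.

Lemma haar_int_walk_mean h n : bounded_measurable h ->
  haar_int (walk_mean h n) = haar_int h.
Proof.
move=> bh; elim: n => [//|n IH] /=.
have bn := walk_mean_bounded_measurable n bh.
rewrite haar_intD; last 2 first.
- by apply: bounded_measurableM; [exact: bounded_measurable_cst|
    exact: bounded_measurable_transl].
- by apply: bounded_measurableM; [exact: bounded_measurable_cst|
    exact: bounded_measurable_transl].
rewrite !haar_intZ; try exact: bounded_measurable_transl.
rewrite !haar_int_transl// IH; ring.
Qed.

(** The identity
    $(pu + (1-p)v)^2 = pu^2 + (1-p)v^2 - p(1-p)(u-v)^2$ holds pointwise; after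
    integration $u$ and $v$ have the same energy, by invariance. *)
Lemma haar_int_sqr_walk_meanS h n : bounded_measurable h ->
  haar_int (fun k => walk_mean h n.+1 k ^+ 2) =
  haar_int (fun k => walk_mean h n k ^+ 2) -
  p n.+1 * (1 - p n.+1) *
  haar_int (fun k => walk_mean (fun k => h (k *m a) - h (k *m invmx a)) n k ^+ 2).
Proof.
move=> bh; have bn := walk_mean_bounded_measurable n bh.
set q := p n.+1.
pose u k := walk_mean h n (k *m a); pose v k := walk_mean h n (k *m invmx a).
have bu : bounded_measurable u by exact: bounded_measurable_transl.
have bv : bounded_measurable v by exact: bounded_measurable_transl.
have bc c : bounded_measurable (fun=> c) by exact: bounded_measurable_cst.
pose w k := u k - v k.
have bw : bounded_measurable w by exact: bounded_measurableB.
have -> : haar_int (fun k => walk_mean h n.+1 k ^+ 2) =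
    haar_int (fun k => (q * (u k * u k) + (1 - q) * (v k * v k)) -
                       q * (1 - q) * (w k * w k)).
  apply: eq_haar_int => k Kk /=; rewrite -/q -/(u k) -/(v k) /w; ring.
have bM := bounded_measurableM.
rewrite haar_intB; [|by apply: bounded_measurableD; auto|by auto].
rewrite haar_intD; [|by auto|by auto].
rewrite !haar_intZ; [|by auto|by auto|by auto].
have -> : haar_int (fun k => u k * u k) =
    haar_int (fun k => walk_mean h n k ^+ 2).
  exact: (@haar_int_transl (fun k => walk_mean h n k ^+ 2) a Ka (bM _ _ bn bn)).
have -> : haar_int (fun k => v k * v k) =
    haar_int (fun k => walk_mean h n k ^+ 2).
  exact: (@haar_int_transl (fun k => walk_mean h n k ^+ 2) _ KVa (bM _ _ bn bn)).
have -> : haar_int (fun k => w k * w k) = haar_int (fun k =>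
    walk_mean (fun k => h (k *m a) - h (k *m invmx a)) n k ^+ 2).
  by apply: eq_haar_int => k Kk; rewrite walk_meanB_transl.
ring.
Qed.

Lemma haar_int_sqr_ge0 h : 0 <= haar_int (fun k => h k ^+ 2).
Proof. by apply: Rintegral_ge0 => k _; exact: sqr_ge0. Qed.

Lemma haar_int_sqr_walk_mean_noninc h m n :
  bounded_measurable h -> (m <= n)%N ->
  haar_int (fun k => walk_mean h n k ^+ 2) <=
  haar_int (fun k => walk_mean h m k ^+ 2).
Proof.
move=> bh /subnK <-; elim: (n - m)%N => [//|i IH].
rewrite addSn haar_int_sqr_walk_meanS//; apply: le_trans IH.
rewrite lerBlDr lerDl mulr_ge0 ?haar_int_sqr_ge0//.
by have /andP[p0 p1] := p01 (i + m).+1; rewrite mulr_ge0 ?subr_ge0.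
Qed.

(** The total energy spent in $n$ steps is at most the initial energy, and each
    unit of variance $p_i(1-p_i)$ costs at least the last difference, which is
    the smallest. *)
Lemma haar_int_sqr_walk_mean_diff_le h n : bounded_measurable h ->
  haar_int (fun k => walk_mean (fun k => h (k *m a) - h (k *m invmx a)) n k ^+ 2)
    * \sum_(1 <= i < n.+1) p i * (1 - p i) <= haar_int (fun k => h k ^+ 2).
Proof.
move=> bh; pose D m := haar_int (fun k =>
  walk_mean (fun k => h (k *m a) - h (k *m invmx a)) m k ^+ 2).
have bd : bounded_measurable (fun k => h (k *m a) - h (k *m invmx a)).
  by apply: bounded_measurableB; exact: bounded_measurable_transl.
rewrite -/(D n).
suff budget m : (m <= n)%N -> D n * \sum_(1 <= i < m.+1) p i * (1 - p i) +
    haar_int (fun k => walk_mean h m k ^+ 2) <= haar_int (fun k => h k ^+ 2).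
  by apply: le_trans (budget n (leqnn n)); rewrite lerDl haar_int_sqr_ge0.
have Dn i : (i <= n)%N -> D n <= D i.
  by move=> mn; exact: haar_int_sqr_walk_mean_noninc.
elim: m => [|m IH] mn.
  by rewrite big_geq// mulr0 add0r.
rewrite big_nat_recr//= haar_int_sqr_walk_meanS// -/(D m).
apply: le_trans (IH (ltnW mn)).
have /andP[p0 p1] := p01 m.+1.
have q0 : 0 <= p m.+1 * (1 - p m.+1) by rewrite mulr_ge0 ?subr_ge0.
have := ler_wpM2l q0 (Dn m (ltnW mn)); lra.
Qed.

Context (diverge : forall M : R, \forall n \near \oo,
  M <= \sum_(1 <= i < n.+1) p i * (1 - p i)).

Lemma haar_int_sqr_walk_mean_diff_near0 h (e : R) : bounded_measurable h ->
  0 < e -> \forall n \near \oo, haar_int (fun k =>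
    walk_mean (fun k => h (k *m a) - h (k *m invmx a)) n k ^+ 2) < e.
Proof.
move=> bh e0; set N := haar_int (fun k => h k ^+ 2).
have N0 : 0 <= N := haar_int_sqr_ge0 h.
apply: filterS (diverge ((N + 1) / e)) => n.
have := haar_int_sqr_walk_mean_diff_le n bh; rewrite -/N.
set D := haar_int _; set S := \sum_(_ <= _ < _) _ => DS NS.
rewrite ltNge; apply/negP => eD.
have : e * ((N + 1) / e) <= D * S.
  by apply: ler_pM => //; [exact: ltW|rewrite divr_ge0// ?ltW// ltr_wpDl].
rewrite mulrCA divff ?gt_eqF// mulr1; lra.
Qed.

(** * From energy to uniform estimates *)

Lemma within_continuous_equicontinuous h (e : R) :
  {within K, continuous h} -> 0 < e ->
  \forall u \near (1%:M : 'M[R]_d),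
    K u -> forall k, K k -> `|h (k *m u) - h k| <= e.
Proof.
move=> /subspace_continuousP ch e0.
pose P (u k : 'M[R]_d) := K u -> K k -> `|h (k *m u) - h k| <= e.
suff : \forall u \near (1%:M : 'M[R]_d), K `<=` P u.
  by apply: filterS => u KP Ku k Kk; exact: KP.
have := (compact_near_coveringP K).1 Kcpt _ (nbhs (1%:M : 'M[R]_d)) P _.
apply => x Kx.
have hx : \forall y \near x, K y -> `|h x - h y| < e / 2.
  have e20 : 0 < e / 2 by rewrite divr_gt0.
  by have /cvgr_dist_lt/(_ _ e20) := ch x Kx.
have hmul : nbhs (x, 1%:M : 'M[R]_d)
    [set q | K (q.1 *m q.2) -> `|h x - h (q.1 *m q.2)| < e / 2].
  apply: (@mulmx_continuous R d (x, 1%:M)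
    [set k | K k -> `|h x - h k| < e / 2] _).
  by rewrite /= mulmx1.
have hfst : nbhs (x, 1%:M : 'M[R]_d) [set q | K q.1 -> `|h x - h q.1| < e / 2].
  exact: (@cvg_fst _ _ (nbhs x) (nbhs (1%:M : 'M[R]_d)) _
    [set k | K k -> `|h x - h k| < e / 2] hx).
suff : nbhs (x, 1%:M : 'M[R]_d) [set q | P q.2 q.1] by [].
apply: filterS2 hmul hfst => q /= q1 q2 Kq2 Kq1.
have := q1 (KM Kq1 Kq2); have := q2 Kq1.
move=> d1 d2; rewrite (splitr e) -(subrKA (h x)).
rewrite (le_trans (ler_normD _ _))// lerD// ltW//.
by rewrite distrC.
Qed.

(** Otherwise each translate of $U$ would be null, and these translates cover
    $K$.  Compactness is used in its near-covering form, along the almost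
    everywhere filter of the Haar measure: almost every $i$ would differ from
    every point of $K$. *)
Lemma haar_open_gt0 (U : set 'M[R]_d) : open U -> U 1%:M ->
  (0 < haar ((K : set (borel_mx R d)) `&` U))%E.
Proof.
move=> oU U1; rewrite lt0e measure_ge0 andbT; apply/eqP => KU0.
have mKU : measurable ((K : set (borel_mx R d)) `&` U).
  by apply: measurableI => //; exact: open_measurable_mx.
pose N (y : 'M[R]_d) : set 'M[R]_d := [set i | U (invmx y *m i)].
have nullN y : K y -> {ae haar, forall i : borel_mx R d, ~ (K i /\ N y i)}.
  move=> Ky; have [uy [_ K1 _ _]] := (so_group_unitmx Kgrp Ky, Kgrp).
  have preE : (fun k => invmx y *m k) @^-1` (K `&` U) = K `&` N y.
    apply/seteqP; split=> k /= [Kk Uk]; split => //.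
      by rewrite -(mulKVmx uy k); exact: KM.
    by apply: KM => //; exact: KV.
  exists (K `&` N y); split.
  - rewrite -preE -[X in measurable X]setTI.
    by apply: continuous_measurable_mx => //; exact: mulmxl_continuous.
  - have := haar_preimage_mull (KV Ky) mKU (@subIsetl _ _ _).
    by rewrite preE => ->.
  - by move=> k /=; rewrite notK.
have KN : {ae haar, forall i : borel_mx R d, K `<=` (fun k => K i -> i <> k)}.
  have := (compact_near_coveringP K).1 Kcpt _ (almost_everywhere haar)
    (fun i k => K i -> i <> k) _.
  apply => y Ky.
  exists (N y, [set i | ~ (K i /\ N y i)]) => /=.
    split; last exact: nullN.
    apply: (@mulmxl_continuous R d (invmx y)); apply: open_nbhs_nbhs.
    by split => //; rewrite mulVmx// (so_group_unitmx Kgrp).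
  by move=> [k i] /= [Nk Ni] Ki ik; apply: Ni; rewrite ik in Ki *.
have [A [mA A0 KA]] := KN.
have : (haar (K : set (borel_mx R d)) <= haar A)%E.
  apply: le_measure; rewrite ?inE// => k Kk; apply: KA => /=.
  by move=> /(_ k Kk Kk); exact.
by rewrite [X in (_ <= X)%E]A0 [X in (X <= _)%E](haarK.1) lee_fin ler10.
Qed.

Lemma le_haar_int_sqr_open h (e : R) (U : set 'M[R]_d) : bounded_measurable h ->
  0 <= e -> open U -> (forall k, K k -> U k -> e <= `|h k|) ->
  e ^+ 2 * fine (haar ((K : set (borel_mx R d)) `&` U)) <=
    haar_int (fun k => h k ^+ 2).
Proof.
move=> bh e0 oU hU.
have mU : measurable (U : set (borel_mx R d)) by exact: open_measurable_mx.
have bI : bounded_measurable (\1_(U : set (borel_mx R d))).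
  split; first exact: measurable_indic.
  by exists 1 => k _; rewrite indicE ger0_norm// lern1 leq_b1.
have -> : fine (haar ((K : set (borel_mx R d)) `&` U)) =
    haar_int (\1_(U : set (borel_mx R d))).
  by rewrite /haar_int /Rintegral integral_indic// setIC.
rewrite -haar_intZ//; apply: le_haar_int.
- by apply: bounded_measurableM => //; exact: bounded_measurable_cst.
- exact: bounded_measurableM.
- move=> k Kk; rewrite indicE; case: (boolP (k \in _)) => [/[1!inE] Uk|_].
    by rewrite mulr1 -(real_normK (num_real (h k))) lerXn2r// ?nnegrE// hU.
  by rewrite mulr0 sqr_ge0.
Qed.

Lemma within_continuous_bounded_measurable h :
  {within K, continuous h} -> bounded_on h -> bounded_measurable h.
Proof.
move=> ch bh; split => //.
by apply: within_continuous_measurable_mx => //; exact: compact_group_closed.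
Qed.

Lemma walk_mean_equicontinuous h (e : R) y n : K y ->
  (forall k, K k -> `|h (k *m y) - h k| <= e) ->
  forall k, K k -> `|walk_mean h n (k *m y) - walk_mean h n k| <= e.
Proof.
have [_ K1 _ _] := Kgrp.
move=> Ky hy k Kk; rewrite -[in X in _ - X](mulmx1 k) -walk_meanB_transl//.
by apply: walk_mean_bound => // l Kl; rewrite mulmx1; exact: hy.
Qed.

(** Uniformity in $k$ makes these $y$ stable under products and inverses, by
    substituting $ky$ for $k$. *)
Definition asymptotic_period h : set 'M[R]_d := [set y | K y /\
  forall e, 0 < e -> \forall n \near \oo,
    forall k, K k -> `|walk_mean h n (k *m y) - walk_mean h n k| <= e].

(** If $|w_n| > e$ at some point of $K$, equicontinuity gives $|w_n| \ge e/2$ on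
    a translate of a fixed neighbourhood $U$ of 1.  The energy of $w_n$ would
    then be at least $(e/2)^2$ times the Haar measure of $U$. *)
Lemma asymptotic_period_sqr h : {within K, continuous h} -> bounded_on h ->
  asymptotic_period h (a *m a).
Proof.
move=> ch bh; have bm := within_continuous_bounded_measurable ch bh.
split=> [|e e0]; first exact: KM.
(* Twice $e/4$: both translates of $h_n$ in $w_n$ may vary. *)
have e40 : 0 < e / 4 by rewrite divr_gt0.
have : nbhs (1%:M : 'M[R]_d)
    [set u | K u -> forall k, K k -> `|h (k *m u) - h k| <= e / 4].
  exact: within_continuous_equicontinuous.
rewrite nbhsE => -[U [oU U1] Uh].
pose c := fine (haar ((K : set (borel_mx R d)) `&` U)).
have c0 : 0 < c.
  rewrite fine_gt0// haar_open_gt0//=.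
  by rewrite (le_lt_trans (probability_le1 _ _)) ?ltry//;
    apply: measurableI => //; exact: open_measurable_mx.
have ec0 : 0 < (e / 2) ^+ 2 * c by rewrite mulr_gt0// exprn_gt0// divr_gt0.
apply: filterS (haar_int_sqr_walk_mean_diff_near0 bm ec0) => n.
set w := walk_mean _ n => wn k Kk.
have bw : bounded_measurable w.
  apply: walk_mean_bounded_measurable; apply: bounded_measurableB;
    exact: bounded_measurable_transl.
have wE z : K z -> w z = walk_mean h n (z *m a) - walk_mean h n (z *m invmx a).
  by move=> Kz; rewrite /w walk_meanB_transl.
have ua := so_group_unitmx Kgrp Ka.
have -> : walk_mean h n (k *m (a *m a)) - walk_mean h n k = w (k *m a).
  by rewrite (wE _ (KM Kk Ka)) mulmxA mulmxK.
rewrite leNgt; apply/negP => ew.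
have Kka := KM Kk Ka.
suff : (e / 2) ^+ 2 * c <= haar_int (fun z => w z ^+ 2) by rewrite leNgt wn.
rewrite -(haar_int_transl Kka (bounded_measurableM bw bw)).
apply: (@le_haar_int_sqr_open (fun z => w (z *m (k *m a)))) => //.
- exact: bounded_measurable_transl.
- by rewrite divr_ge0// ltW.
move=> u Ku Uu; have hu := walk_mean_equicontinuous n Ku (Uh u Uu Ku).
rewrite (Kab Ku Kka) (wE _ (KM Kka Ku)); move: ew; rewrite (wE _ Kka).
have := hu _ (KM Kka Ka); have := hu _ (KM Kka KVa).
rewrite -!mulmxA (Kab Ka Ku) (Kab KVa Ku) !mulmxA.
set x1 := walk_mean _ _ _; set x2 := walk_mean _ _ _.
set x3 := walk_mean _ _ _; set x4 := walk_mean _ _ _.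
move=> H1 H2 H3; rewrite leNgt; apply/negP => H4.
move: H1 H2 H3 H4; rewrite !ler_norml ltr_normr ltr_norml.
by move=> /andP[? ?] /andP[? ?] /orP[?|?] /andP[? ?]; lra.
Qed.

Lemma asymptotic_period_subgroup h : is_subgroup_SO (asymptotic_period h).
Proof.
have [KSO K1 _ _] := Kgrp.
split=> [y [/KSO]//||y z [Ky hy] [Kz hz]|y [Ky hy]].
- split=> // e e0; near=> n => k Kk.
  by rewrite mulmx1 subrr normr0 ltW.
- split=> [|e e0]; first exact: KM.
  have e20 : 0 < e / 2 by rewrite divr_gt0.
  apply: filterS2 (hy _ e20) (hz _ e20) => n hny hnz k Kk.
  rewrite mulmxA (splitr e) -(subrKA (walk_mean h n (k *m y))).
  rewrite (le_trans (ler_normD _ _))// lerD//; last exact: hny.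
  by apply: hnz; exact: KM.
- split=> [|e e0]; first exact: KV.
  apply: filterS (hy _ e0) => n hny k Kk.
  have := hny _ (KM Kk (KV Ky)).
  by rewrite mulmxKV ?(so_group_unitmx Kgrp)// distrC.
Unshelve. all: by end_near. Qed.

Lemma asymptotic_period_closed h : {within K, continuous h} ->
  closed (asymptotic_period h).
Proof.
move=> ch y cly.
have Ky : K y.
  apply: compact_group_closed; apply: closureS cly => z; by case.
have uy := so_group_unitmx Kgrp Ky.
split=> // e e0; have e20 : 0 < e / 2 by rewrite divr_gt0.
have hU := within_continuous_equicontinuous ch e20.
have [z [[Kz hz] /= Uz]] := cly _ (nbhs_mulVmx uy hU).
have Kyz : K (invmx y *m z) by apply: KM => //; exact: KV.
apply: filterS (hz _ e20) => n hnz k Kk.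
rewrite (splitr e) -(subrKA (walk_mean h n (k *m z))).
rewrite (le_trans (ler_normD _ _))// lerD//; last exact: hnz.
have := walk_mean_equicontinuous n Kyz (Uz Kyz) (KM Kk Ky).
by rewrite mulmxA mulmxK// distrC.
Qed.

(** Every element of $K$ being an asymptotic period, compactness and
    equicontinuity make $h_n - h_n(1)$ uniformly small on $K$, while the Haar
    integral of $h_n$ does not depend on $n$. *)
Lemma walk_mean_cvg h : connected K -> closed_subgroup_generated a = K ->
  {within K, continuous h} -> bounded_on h ->
  walk_mean h n 1%:M @[n --> \oo] --> haar_int h.
Proof.
move=> Kconn Kgen ch bh; have [_ K1 _ _] := Kgrp.
have bm := within_continuous_bounded_measurable ch bh.
have periodK : asymptotic_period h = K.
  apply: (square_generates Kgrp Kab Kconn Ka Kgen).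
  - exact: asymptotic_period_subgroup.
  - exact: asymptotic_period_closed.
  - by move=> y [].
  - exact: asymptotic_period_sqr.
apply/cvgrPdist_le => e e0; have e20 : 0 < e / 2 by rewrite divr_gt0.
have flat : \forall n \near \oo,
    K `<=` (fun y => K y -> `|walk_mean h n y - walk_mean h n 1%:M| <= e).
  have := (compact_near_coveringP K).1 Kcpt _
    (nbhs (\oo%classic : set_system nat))
    (fun n y => K y -> `|walk_mean h n y - walk_mean h n 1%:M| <= e) _.
  apply => y Ky; have uy := so_group_unitmx Kgrp Ky.
  have [_ /(_ _ e20) hy] : asymptotic_period h y by rewrite periodK.
  have hU := nbhs_mulVmx uy (within_continuous_equicontinuous ch e20).
  exists ([set z | K (invmx y *m z) ->
    forall k, K k -> `|h (k *m (invmx y *m z)) - h k| <= e / 2],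
    [set n | forall k, K k ->
      `|walk_mean h n (k *m y) - walk_mean h n k| <= e / 2]) => //.
  move=> [z n] /= [Uz hn] Kz.
  have Kyz : K (invmx y *m z) by apply: KM => //; exact: KV.
  rewrite (splitr e) -(subrKA (walk_mean h n y)).
  rewrite (le_trans (ler_normD _ _))// lerD//.
    by have := walk_mean_equicontinuous n Kyz (Uz Kyz) Ky; rewrite mulKVmx.
  by have := hn _ K1; rewrite mul1mx.
apply: filterS flat => n flat.
have bn := walk_mean_bounded_measurable n bm.
have bc c := bounded_measurable_cst c.
rewrite -(haar_int_walk_mean n bm) -[X in _ - X]haar_int_cst.
rewrite ler_norml; apply/andP; split.
- rewrite -haar_intB// -[X in X <= _]haar_int_cst; apply: le_haar_int => //.
    exact: bounded_measurableB.
  by move=> k Kk; have := flat k Kk Kk; rewrite ler_norml => /andP[].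
- rewrite -haar_intB// -[X in _ <= X]haar_int_cst; apply: le_haar_int => //.
    exact: bounded_measurableB.
  by move=> k Kk; have := flat k Kk Kk; rewrite ler_norml => /andP[].
Qed.

End HaarIntegral.

(** * Integrals over conull sets *)

Section ConullIntegral.
Context (R : realType) (dO : measure_display) (Omega : measurableType dO)
  (P : {measure set Omega -> \bar R}).
Context (G : set Omega) (mG : measurable G) (G_conull : P (~` G) = 0%E).

Import HBNNSimple.

(** [F] need not be measurable outside [G].  The integral is a supremum over
    simple functions, which are measurable and can be cut down to [G]. *)
Lemma ge0_integral_conull (F : Omega -> \bar R) : measurable_fun G F ->
  (forall w, (0 <= F w)%E) ->
  (\int[P]_w F w = \int[P]_(w in G) F w)%E.
Proof.
move=> mF F0; apply/eqP; rewrite eq_le; apply/andP; split.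
  rewrite ge0_integralTE//; apply: ge_ereal_sup => _ [h /= hF <-].
  rewrite -integralT_nnsfun (@ge0_negligible_integral _ _ _ P setT (~` G))//.
  - rewrite setTD setCK; apply: ge0_le_integral => //.
    + by move=> w _; rewrite lee_fin.
    + by apply: measurable_funTS; apply/measurable_EFinP.
  - exact: measurableC.
  - by apply/measurable_EFinP.
  - by move=> w _; rewrite lee_fin.
rewrite ge0_integralTE// ge0_integralE//; apply: ge_ereal_sup => _ [h /= hF <-].
apply: ereal_sup_ubound; exists h => //= w; apply: le_trans (hF w) _.
by rewrite patchE; case: ifPn.
Qed.

Lemma Rintegral_conull (F : Omega -> R) : measurable_fun G F ->
  \int[P]_w F w = \int[P]_(w in G) F w.
Proof.
move=> mF; congr fine; rewrite integralE [RHS]integralE; congr (_ - _)%E.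
  apply: ge0_integral_conull => //.
  by apply: measurable_funepos; exact/measurable_EFinP.
apply: ge0_integral_conull => //.
by apply: measurable_funeneg; exact/measurable_EFinP.
Qed.

End ConullIntegral.

(** * Expectations along the walk *)

(** Makes the lemmas on iterated operators available for products of
    square matrices of any size, including 0. *)
HB.instance Definition _ (R : pzSemiRingType) (d : nat) :=
  Monoid.isLaw.Build 'M[R]_d 1%:M (@mulmx R d d d)
    (@mulmxA R d d d d) (@mul1mx R d d) (@mulmx1 R d d).

Section WalkExpectation.
Context (R : realType) (d : nat) (K : set 'M[R]_d).
Context (Kgrp : is_subgroup_SO K) (Kab : is_abelian K).
Context (a : 'M[R]_d) (Ka : K a) (aV : a <> invmx a) (p : nat -> R).
Context (dO : measure_display) (Omega : measurableType dO)
  (P : probability Omega R) (X : nat -> Omega -> borel_mx R d).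
Context (mX : forall j, (1 <= j)%N -> measurable_fun setT (X j))
  (KX : forall j w, (1 <= j)%N -> K (X j w))
  (indep : mutually_independent P [set j | (1 <= j)%N] X)
  (lawX : forall j, (1 <= j)%N ->
     P [set w | X j w = a] = (p j)%:E /\
     P [set w | X j w = invmx a] = (1 - p j)%:E).

Local Notation Z n w := (\big[mulmx/1%:M]_(1 <= j < n.+1) X j w).

(** Outside this conull event the steps are arbitrary elements of $K$, and
    nothing is known about measurability of their product. *)
Definition two_valued : set Omega :=
  [set w | forall j, (1 <= j)%N -> X j w = a \/ X j w = invmx a].

Definition cylinder (J : {fset nat}) (B : nat -> set (borel_mx R d)) :=
  \bigcap_(j in [set` J]) (X j @^-1` B j).

Let KVa : K (invmx a). Proof. by case: Kgrp => _ _ _; exact. Qed.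
Let KM A B : K A -> K B -> K (A *m B).
Proof. by case: Kgrp => _ _ + _; exact. Qed.

Lemma measurable_mx1 (A : 'M[R]_d) : measurable ([set A] : set (borel_mx R d)).
Proof.
apply: closed_measurable_mx; apply: accessible_closed_set1.
by apply: hausdorff_accessible; exact: norm_hausdorff.
Qed.

Lemma measurable_step j (B : set (borel_mx R d)) : (1 <= j)%N -> measurable B ->
  measurable (X j @^-1` B).
Proof. by move=> j1 mB; rewrite -[X in measurable X]setTI; exact: mX. Qed.

Lemma two_valuedE :
  two_valued = \bigcap_(j in [set j | (1 <= j)%N])
    (X j @^-1` [set a] `|` X j @^-1` [set invmx a]).
Proof. by apply/seteqP; split=> w Gw j /Gw. Qed.

Lemma measurable_two_valued : measurable two_valued.
Proof.
rewrite two_valuedE; apply: bigcap_measurable.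
  by exists 1%N.
by move=> j j1; apply: measurableU; apply: measurable_step => //;
  exact: measurable_mx1.
Qed.

Lemma two_valued_conull : P (~` two_valued) = 0%E.
Proof.
suff : P.-negligible (~` two_valued).
  by move/negligibleP; apply; apply: measurableC; exact: measurable_two_valued.
rewrite two_valuedE setC_bigcap bigcup_mkcond; apply: negligible_bigcup => j.
case: ifPn => [/[1!inE] j1|_]; last exact: negligible_set0.
have m1 := measurable_step j1 (measurable_mx1 a).
have m2 := measurable_step j1 (measurable_mx1 (invmx a)).
have mU := measurableU _ _ m1 m2.
apply/negligibleP; first exact: measurableC.
apply: etrans (probability_setC P mU) _; rewrite measureU//; last first.
  by rewrite -preimage_setI; apply/seteqP; split => // w [-> /aV].
have [Pa PV] := lawX j1.
transitivity (1 - ((p j)%:E + (1 - p j)%:E))%E.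
  by congr (1 - (_ + _))%E.
by rewrite -EFinD addrC subrK subrr.
Qed.

Lemma walkS n w : Z n.+1 w = Z n w *m X n.+1 w.
Proof. by rewrite big_nat_recr. Qed.

Lemma walk_in n w : K (Z n w).
Proof.
have [_ K1 _ _] := Kgrp.
elim: n => [|n IH]; first by rewrite big_geq.
by rewrite walkS; apply: KM => //; exact: KX.
Qed.

Lemma measurable_walk (phi : 'M[R]_d -> R) n k : K k ->
  measurable_fun two_valued (fun w => phi (k *m Z n w)).
Proof.
have mG := measurable_two_valued.
elim: n k => [|n IH] k Kk.
  by under eq_fun do rewrite big_geq//; exact: measurable_cst.
have step b : K b -> measurable_fun (two_valued `&` X n.+1 @^-1` [set b])
    (fun w => phi (k *m Z n.+1 w)).
  move=> Kb; apply: (eq_measurable_fun (fun w => phi ((k *m b) *m Z n w))).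
    move=> w /[1!inE] -[Gw /= Xb]; rewrite walkS Xb -mulmxA.
    by rewrite (Kab Kb (walk_in n w)).
  apply: measurable_funS (IH _ (KM Kk Kb)) => //.
have -> : two_valued = (two_valued `&` X n.+1 @^-1` [set a]) `|`
    (two_valued `&` X n.+1 @^-1` [set invmx a]).
  by rewrite -setIUr; apply/seteqP; split=> [w Gw|w []//]; split=> //; exact: Gw.
apply/measurable_funU; [| |by split; exact: step].
- by apply: measurableI => //; apply: measurable_step => //;
    exact: measurable_mx1.
- by apply: measurableI => //; apply: measurable_step => //;
    exact: measurable_mx1.
Qed.

Lemma measurable_cylinder J B : (forall j, j \in J -> (1 <= j)%N) ->
  (forall j, j \in J -> measurable (B j)) -> measurable (cylinder J B).
Proof.
move=> J1 mB; apply: fin_bigcap_measurable => [|j Jj]; first exact: finite_fset.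
by apply: measurable_step; [exact: J1|exact: mB].
Qed.

Definition prescribe j (b : 'M[R]_d) (B : nat -> set (borel_mx R d)) i :
  set (borel_mx R d) := if i == j then [set b] else B i.

Lemma cylinder_prescribe J B j b : (j \notin J)%fset ->
  cylinder (j |` J)%fset (prescribe j b B) =
  X j @^-1` [set b] `&` cylinder J B.
Proof.
move=> jJ; apply/seteqP; split=> [w Cw|w [Xjb Cw] i /=].
  split; first by have := Cw j (fset1U1 j J); rewrite /prescribe eqxx.
  move=> i /= iJ; have := Cw i (fset1Ur _ iJ).
  by rewrite /prescribe; case: eqP => // ij; rewrite -ij iJ in jJ.
rewrite in_fset1U /prescribe; case: eqP => [->//|_ /= iJ]; exact: Cw.
Qed.

Lemma measurable_prescribe J B j b : (forall i, i \in J -> measurable (B i)) ->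
  forall i, i \in (j |` J)%fset -> measurable (prescribe j b B i).
Proof.
move=> mB i; rewrite in_fset1U /prescribe; case: eqP => [_ _|_ /= iJ].
  exact: measurable_mx1.
exact: mB.
Qed.

Lemma probability_prescribe J B j b : (1 <= j)%N ->
  (forall i, i \in J -> (j < i)%N) -> (forall i, i \in J -> measurable (B i)) ->
  P (cylinder (j |` J)%fset (prescribe j b B)) =
  (P [set w | X j w = b] * P (cylinder J B))%E.
Proof.
move=> j1 Jj mB.
have jJ : (j \notin J)%fset by apply/negP => /Jj; rewrite ltnn.
have J1 : [set` J] `<=` [set i | (1 <= i)%N].
  by move=> i /= /Jj; apply: leq_trans.
rewrite /cylinder indep//; last 2 first.
- by move=> i /=; rewrite in_fset1U => /orP[/eqP->//|]; exact: J1.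
- exact: measurable_prescribe.
rewrite big_fsetU1//= {1}/prescribe eqxx; congr (_ * _)%E.
rewrite indep//; apply: eq_big_seq => i iJ; rewrite /prescribe.
by case: eqP => // ij; rewrite -ij iJ in jJ.
Qed.

(** Induction on $n$: on the cylinder, split the event according to the value of
    $R_{n+1}$, which prescribes one more coordinate and multiplies the starting
    point by $a^{\pm 1}$.  The cylinder lies strictly beyond time $n$, which is
    what keeps the induction going. *)
Lemma Rintegral_walk_cylinder phi n J B k : bounded_on K phi -> K k ->
  (forall j, j \in J -> (n < j)%N) -> (forall j, j \in J -> measurable (B j)) ->
  \int[P]_(w in two_valued `&` cylinder J B) phi (k *m Z n w) =
  walk_mean a p phi n k * fine (P (cylinder J B)).
Proof.
move=> [M phiM].
have mG := measurable_two_valued.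
elim: n J B k => [|n IH] J B k Kk Jn mB.
  have mC : measurable (cylinder J B) by exact: measurable_cylinder.
  under eq_Rintegral do rewrite big_geq// mulmx1.
  rewrite Rintegral_cst; last exact: measurableI.
  congr (_ * fine _); rewrite setIC.
  apply: esym; apply: etrans (measureDI P mC mG) _.
  rewrite [X in (X + _)%E](_ : _ = 0%E) ?add0e//.
  apply: (subset_measure0 _ _ _ two_valued_conull).
  - exact: measurableD.
  - exact: measurableC.
  - by move=> w [].
have Jn' i : i \in J -> (n.+1 < i)%N by exact: Jn.
have nJ : (n.+1 \notin J)%fset by apply/negP => /Jn; rewrite ltnn.
have mC : measurable (cylinder J B).
  by apply: measurable_cylinder => // j /Jn; apply: leq_trans.
have fixed b : K b ->
    \int[P]_(w in two_valued `&` (X n.+1 @^-1` [set b] `&` cylinder J B))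
      phi (k *m Z n.+1 w) =
    walk_mean a p phi n (k *m b) *
      (fine (P [set w | X n.+1 w = b]) * fine (P (cylinder J B))).
  move=> Kb; rewrite -fineM ?fin_num_measure//; last first.
    exact: (measurable_step (isT : (1 <= n.+1)%N) (measurable_mx1 b)).
  rewrite -probability_prescribe// -IH; last 3 first.
  - exact: KM.
  - by move=> i; rewrite in_fset1U => /orP[/eqP->//|/Jn']; exact: ltn_trans.
  - exact: measurable_prescribe.
  rewrite cylinder_prescribe//; apply: eq_Rintegral => w /[1!inE].
  move=> -[_ [/= Xb _]]; rewrite walkS Xb -mulmxA.
  by rewrite (Kab Kb (walk_in n w)).
have m1 b : measurable (X n.+1 @^-1` [set b] `&` cylinder J B).
  apply: measurableI => //; apply: measurable_step => //; exact: measurable_mx1.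
have -> : two_valued `&` cylinder J B =
    (two_valued `&` (X n.+1 @^-1` [set a] `&` cylinder J B)) `|`
    (two_valued `&` (X n.+1 @^-1` [set invmx a] `&` cylinder J B)).
  rewrite -setIUr -setIUl; apply/seteqP; split=> [w [Gw Cw]|w [Gw [_ Cw]]] //.
  by split=> //; split=> //; exact: Gw.
have mU b : measurable (two_valued `&` (X n.+1 @^-1` [set b] `&` cylinder J B)).
  exact: measurableI.
rewrite Rintegral_setU//; last 2 first.
- apply: measurable_bounded_integrable; first exact: measurableU.
  + by rewrite (le_lt_trans (probability_le1 _ _))// ?ltry//; exact: measurableU.
  + apply: measurable_funS (@measurable_walk phi n.+1 k Kk) => //.
    by move=> w [] [].
  + exists M; split; first exact: num_real.
    by move=> x Mx w _ /=; apply: le_trans (ltW Mx); apply: phiM;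
      apply: KM => //; exact: walk_in.
- rewrite disj_set2E; apply/eqP/seteqP; split=> // w.
  by move=> [[_ [/= -> _]] [_ [/= /aV]]].
rewrite !fixed//=; have [-> ->] := lawX (isT : (1 <= n.+1)%N).
by rewrite /=; ring.
Qed.

Lemma Rintegral_walk phi n : bounded_on K phi ->
  \int[P]_w phi (Z n w) = walk_mean a p phi n 1%:M.
Proof.
move=> bphi; have [_ K1 _ _] := Kgrp.
have mG := measurable_two_valued.
have mphi : measurable_fun two_valued (fun w => phi (Z n w)).
  have := @measurable_walk phi n 1%:M K1; congr measurable_fun.
  by apply/funext => w; rewrite mul1mx.
rewrite (Rintegral_conull mG two_valued_conull mphi).
have C0 : cylinder fset0 (fun=> setT) = setT by apply/seteqP; split.
have := @Rintegral_walk_cylinder phi n fset0 (fun=> setT) 1%:M bphi K1.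
rewrite C0 setIT probability_setT mulr1 => <- //.
by apply: eq_Rintegral => w _; rewrite mul1mx.
Qed.

End WalkExpectation.

(** * Divergence of the variances, and the theorem *)

(** A null integral of $f(1-f) \ge 0$ would force $f$ to take values in
    $\{0,1\}$ almost everywhere. *)
Lemma Rintegral_variance_gt0 (R : realType) (dE : measure_display)
    (E : measurableType dE) (rho : probability E R) (f : E -> R) :
  measurable_fun setT f -> (forall x, 0 <= f x <= 1) ->
  ~ (exists A : set E, measurable A /\ {ae rho, forall x, f x = \1_A x}) ->
  0 < \int[rho]_x (f x * (1 - f x)).
Proof.
move=> mf f01 f_not_indic; pose g x := f x * (1 - f x).
have g0 x : 0 <= g x.
  by have /andP[f0 f1] := f01 x; rewrite mulr_ge0// subr_ge0.
have mg : measurable_fun setT g.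
  by apply: measurable_funM => //; apply: measurable_funB.
have ig : rho.-integrable setT (EFin \o g).
  apply: measurable_bounded_integrable => //.
    by rewrite (le_lt_trans (probability_le1 _ _))// ltry.
  exists 1; split; first exact: num_real.
  move=> M M1 x _ /=; have /andP[f0 f1] := f01 x.
  rewrite ger0_norm//; apply: le_trans (ltW M1).
  by rewrite /g mulr_ile1// ?subr_ge0// lerBlDr lerDl.
have int_ge0 : 0 <= \int[rho]_x g x by apply: Rintegral_ge0 => x _; exact: g0.
rewrite lt0r int_ge0 andbT; apply/eqP => int0.
apply: f_not_indic; exists (f @^-1` [set 1]); split.
  by rewrite -[X in measurable X]setTI; exact: mf.
have : ae_eq rho setT (EFin \o g) (cst 0%E).
  apply/(ae_eq_integral_abs _ measurableT); first exact/measurable_EFinP.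
  rewrite (eq_integral (EFin \o g)); last first.
    by move=> x _; rewrite gee0_abs// lee_fin.
  by rewrite -[LHS]fineK ?(integrable_fin_num _ ig)//; congr EFin.
apply: filterS => x /(_ Logic.I) /= [] /eqP.
rewrite indicE mulf_eq0 subr_eq0 => /orP[/eqP f0|/eqP f1].
  by rewrite memNset ?f0//= f0 => /esym/eqP; rewrite oner_eq0.
by rewrite mem_set -?f1.
Qed.

(** With $c$ the integral of $g$ and deviation at most
    $(c/2)\sqrt n \le (c/2)n$, the sums are at least $(c/2)n$. *)
Lemma class_C2_sum_diverge (R : realType) (dE : measure_display)
    (E : measurableType dE) (rho : probability E R) (tau : E -> E)
    (g : E -> R) (x : E) (M : R) :
  class_C2 rho tau g -> 0 < \int[rho]_y g y ->
  \forall n \near \oo, M <= \sum_(1 <= i < n.+1) g (iter i tau x).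
Proof.
move=> [_ gC2]; set c := \int[rho]_y g y => c0.
have c20 : 0 < c / 2 by rewrite divr_gt0.
apply: filterS2 (gC2 _ c20) (nbhs_infty_ger (M / (c / 2))) => n devn nM.
have : `|\sum_(1 <= i < n.+1) (g (iter i tau x) - c)| <= c / 2 * Num.sqrt n%:R.
  by rewrite -lee_fin; apply: le_trans devn; apply: ereal_sup_ubound; exists x.
have sqrtn : Num.sqrt (n%:R : R) <= n%:R.
  case: n {devn nM} => [|n]; first by rewrite sqrtr0.
  rewrite -[leRHS]ger0_norm// -sqrtr_sqr ler_sqrt ?exprn_ge0//.
  by rewrite expr2 ler_peMr// ler1n.
have -> : \sum_(1 <= i < n.+1) (g (iter i tau x) - c) =
    \sum_(1 <= i < n.+1) g (iter i tau x) - n%:R * c.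
  by rewrite sumrB sumr_const_nat subSS subn0 mulr_natl.
rewrite ler_norml => /andP[+ _].
move: nM; rewrite ler_pdivrMr// => nM.
have := ler_wpM2l (ltW c20) sqrtn; lra.
Qed.

(** Here $a^2 = 1$, so that the trivial subgroup already contains $a^2$. *)
Lemma involutive_generator_trivial (R : realType) (d : nat) (K : set 'M[R]_d)
    (a : 'M[R]_d) :
  is_subgroup_SO K -> is_abelian K -> connected K -> K a ->
  closed_subgroup_generated a = K -> a = invmx a -> K = [set 1%:M].
Proof.
move=> Kgrp Kab Kconn Ka Kgen aV; have [KSO K1 _ _] := Kgrp.
apply/esym/(square_generates Kgrp Kab Kconn Ka Kgen).
- split=> [_ -> | // | A B -> -> | A ->]; first exact: KSO.
    by rewrite /= mulmx1.
  by rewrite /= invmx1.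
- by apply: accessible_closed_set1; apply: hausdorff_accessible;
    exact: norm_hausdorff.
- by move=> _ ->.
- by rewrite /= {2}aV mulmxV// (so_group_unitmx Kgrp).
Qed.

Theorem theorem3p4 (R : realType) (d : nat)
    (K : set 'M[R]_d) (a : 'M[R]_d)
    (K_subgroup : is_subgroup_SO K) (K_abelian : is_abelian K)
    (K_compact : compact K) (K_connected : connected K)
    (a_in_K : K a) (a_generates : closed_subgroup_generated a = K)
    (haar : probability (borel_mx R d) R) (haarK : is_haar_measure K haar)
    (dE : measure_display) (E : measurableType dE) (rho : probability E R)
    (tau : E -> E) (tau_meas : measurable_fun setT tau)
    (f : E -> R) (f_meas : measurable_fun setT f)
    (f_01 : forall x, 0 <= f x <= 1)
    (f_C2 : class_C2 rho tau (fun x => f x * (1 - f x)))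
    (f_not_indic : ~ exists A : set E,
        measurable A /\ {ae rho, forall x, f x = \1_A x}) :
  {ae rho, forall x : E,
    forall (dO : measure_display) (Omega : measurableType dO)
      (P : probability Omega R) (X : nat -> Omega -> borel_mx R d),
    (forall j, (1 <= j)%N -> measurable_fun setT (X j)) ->
    (forall j w, (1 <= j)%N -> K (X j w)) ->
    mutually_independent P [set j | (1 <= j)%N] X ->
    (forall j, (1 <= j)%N ->
       P [set w | X j w = a] = (f (iter j tau x))%:E /\
       P [set w | X j w = invmx a] = (1 - f (iter j tau x))%:E) ->
    cvg_in_law P K
      (fun n w => \big[mulmx/1%:M]_(1 <= j < n.+1) X j w) haar}.
Proof.
have variance_gt0 := Rintegral_variance_gt0 f_meas f_01 f_not_indic.
apply: aeW => x dO Omega P X mX KX indep lawX phi cphi bphi.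
(* If $a = a^{-1}$ then $K$ is trivial and the law of a step is
   contradictory: both probabilities would be 1. *)
have [aV|aV] := pselect (a = invmx a).
  have K1 := involutive_generator_trivial K_subgroup K_abelian K_connected
    a_in_K a_generates aV.
  have X1E b : K b -> [set w | X 1%N w = b] = setT.
    rewrite K1 => ->; apply/seteqP; split=> // w _ /=.
    by have := KX 1%N w isT; rewrite K1.
  have [] := lawX 1%N isT.
  rewrite !X1E -?aV// probability_setT => -[f1] -[].
  by rewrite -f1 subrr => /eqP; rewrite oner_eq0.
pose p j := f (iter j tau x).
have diverge M : \forall n \near \oo,
    M <= \sum_(1 <= i < n.+1) p i * (1 - p i).
  exact: class_C2_sum_diverge f_C2 variance_gt0.
have -> : (fun n => \int[P]_w phi (\big[mulmx/1%:M]_(1 <= j < n.+1) X j w)) =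
    (fun n => walk_mean a p phi n 1%:M).
  apply/funext => n.
  exact: (@Rintegral_walk _ _ K K_subgroup K_abelian a a_in_K aV p).
exact: (walk_mean_cvg K_subgroup K_abelian K_compact haarK a_in_K
  (fun j => f_01 (iter j tau x)) diverge
  K_connected a_generates cphi bphi).
Qed.
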